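(* Let $n\ge 2$, let $m$ be a positive integer, and let $u=(u_1,\ldots,u_n)^\top$, $v=(v_1,\ldots,v_n)^\top\in\mathbb{Z}^n\setminus\{0\}$, where $\langle u\rangle=a\mathbb{Z}$. Then $u$ and $v$ are in the same $\Gamma_{n,m}$-orbit if and only if $\langle u\rangle=\langle v\rangle$ and $u_i\equiv v_i \pmod{am}$ for all $1\le i\le n$.
   Context: $\Gamma_{n,m}$ is the principal congruence subgroup of level $m$ in $\mathrm{SL}(n,\mathbb{Z})$, i.e. the kernel of entrywise reduction $\mathrm{SL}(n,\mathbb{Z})\to\mathrm{SL}(n,\mathbb{Z}/m\mathbb{Z})$, acting on column vectors in $\mathbb{Z}^n$ by left multiplication. For $u=(u_1,\ldots,u_n)^\top\in\mathbb{Z}^n$, $\langle u\rangle$ denotes the ideal of $\mathbb{Z}$ generated by $u_1,\ldots,u_n$. *)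

(* Defs.v *)
From HB Require Import structures.
From mathcomp Require Import all_boot all_order all_algebra.
Set Implicit Arguments.
Unset Strict Implicit.
Unset Printing Implicit Defensive.
Local Open Scope ring_scope.

(* Entrywise reduction modulo m, with residue classes represented by their
   canonical representatives in int; 'Z_m is avoided because 'Z_1 is Z/2. *)
Definition reduce_mx (n m : nat) (A : 'M[int]_n) : 'M[int]_n :=
  map_mx (fun x => (x %% m)%Z) A.

Definition SL_int (n : nat) (A : 'M[int]_n) : Prop := \det A = 1.

Definition Gamma (n m : nat) (A : 'M[int]_n) : Prop :=
  SL_int A /\ reduce_mx m A = reduce_mx m 1%:M.

Definition Gamma_orbit (n m : nat) (u w : 'cV[int]_n) : Prop :=
  exists2 A : 'M[int]_n, Gamma m A & w = A *m u.

Definition entries_ideal (n : nat) (u : 'cV[int]_n) (x : int) : Prop :=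
  exists c : 'I_n -> int, x = \sum_(i < n) c i * u i 0.

Definition principal_ideal (a x : int) : Prop := exists k : int, x = a * k.

(* Equality of subsets of int, i.e. extensional equality of predicates. *)
Definition same_ideal (I J : int -> Prop) : Prop := forall x, I x <-> J x.

(* Main.v *)
(* Every integer column is carried to a multiple of the first basis vector by a
   matrix of GL(n, Z), and conjugation by GL(n, Z) preserves the congruence
   subgroup. After dividing by a and such a change of coordinates, the theorem
   says that a primitive vector e_1 + m y lies in the orbit of e_1. A further
   change of the last n - 1 coordinates reduces y to s e_1 + d e_2, and then
   Bezout coefficients for the coprime pair (1 + m s, m^2 d) complete the column
   (1 + m s, m d) to a matrix of determinant 1 congruent to the identity mod m. *)
Require Import Defs.
From HB Require Import structures.
From mathcomp Require Import all_boot all_order all_algebra.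
From mathcomp Require Import ring.
Set Implicit Arguments.
Unset Strict Implicit.
Unset Printing Implicit Defensive.
Import GRing.Theory.
Local Open Scope ring_scope.

(** The additive form [1 + m X] turns conjugation and the action on a column into calculations
    linear in [X]. *)
Lemma GammaP (n m : nat) (A : 'M[int]_n) :
  Gamma m A <-> \det A = 1 /\ exists X : 'M[int]_n, A = 1%:M + m%:Z *: X.
Proof.
split=> [[detA /matrixP eqA]|[detA [X defA]]]; split=> //.
- have dvdA i j : (m%:Z %| A i j - (1%:M : 'M[int]_n) i j)%Z.
    by rewrite -eqz_mod_dvd; apply/eqP; have := eqA i j; rewrite !mxE.
  exists (\matrix_(i, j) ((A i j - (1%:M : 'M[int]_n) i j) %/ m)%Z).
  apply/matrixP=> i j; rewrite [RHS]mxE [X in _ + X]mxE [X in m%:Z * X]mxE.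
  by rewrite mulrC divzK ?dvdA // addrC subrK.
- rewrite defA; apply/matrixP=> i j; rewrite !mxE; apply/eqP.
  by rewrite eqz_mod_dvd addrAC subrr add0r dvdz_mulr.
Qed.

Lemma Gamma_orbit_unitmx (n m : nat) (g : 'M[int]_n) (u v : 'cV[int]_n) :
  g \in unitmx -> Gamma_orbit m (g *m u) (g *m v) -> Gamma_orbit m u v.
Proof.
move=> gU [A /GammaP[detA [X defA]] eqv].
exists (invmx g *m A *m g); last by rewrite -!mulmxA -eqv mulKmx.
apply/GammaP; split.
  by rewrite !det_mulmx mulrAC -det_mulmx mulVmx // det1 mul1r.
exists (invmx g *m X *m g).
by rewrite defA mulmxDr mulmxDl mulmx1 mulVmx // -scalemxAr -scalemxAl.
Qed.

Lemma Gamma_orbitZ (n m : nat) (a : int) (u v : 'cV[int]_n) :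
  Gamma_orbit m u v -> Gamma_orbit m (a *: u) (a *: v).
Proof. by case=> A GA ->; exists A; rewrite // scalemxAr. Qed.

(** Smith normal form of a one-column matrix: the diagonal part has a single entry, and the right
    factor is a 1 by 1 matrix, so both are absorbed into the scalar [d]. *)
Lemma unitmx_mul_delta (n : nat) (y : 'cV[int]_n.+1) :
  exists2 g : 'M[int]_n.+1, g \in unitmx &
    exists d : int, g *m y = d *: delta_mx 0 0.
Proof.
have [L LU [R RU [d _ ->]]] := int_Smith_normal_form y.
exists (invmx L); first by rewrite unitmx_inv.
exists (d`_0 * R 0 0); rewrite -mulmxA mulKmx //.
apply/matrixP=> i j; rewrite (ord1 j) !mxE big_ord1 !mxE /=.
by case: i => -[|i] lti; rewrite ?eqxx ?mulr1 // mulr0n mul0r mulr0.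
Qed.

(** The scalar [e] left by the reduction divides [c *m u = 1], so it is a unit and can be moved into
    [g]. *)
Lemma unitmx_mul_primitive (n : nat) (u : 'cV[int]_n.+1) (c : 'rV[int]_n.+1) :
  c *m u = 1%:M ->
  exists2 g : 'M[int]_n.+1, g \in unitmx & g *m u = delta_mx 0 0.
Proof.
move=> cu; have [g gU [e gu]] := unitmx_mul_delta u.
have eU : e \is a GRing.unit.
  have: e * (c *m invmx g *m delta_mx 0 0 : 'M_1) 0 0 = 1.
    have := congr1 (fun M : 'M_1 => M 0 0) cu.
    by rewrite -{1}(mulKmx gU u) gu mulmxA -scalemxAr !mxE.
  by move=> e1; apply/unitrPr; exists ((c *m invmx g *m delta_mx 0 0 : 'M_1) 0 0).
exists (e^-1 *: g); first by rewrite unitmxZ // unitrV.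
by rewrite -scalemxAl gu scalerA mulVr // scale1r.
Qed.

Lemma det_mx2 (R : comNzRingType) (A : 'M[R]_2) :
  \det A = A 0 0 * A 1 1 - A 0 1 * A 1 0.
Proof.
rewrite (expand_det_row _ 0) !big_ord_recl big_ord0 addr0 /cofactor !det_mx11.
rewrite !mxE /= expr0 expr1 mul1r mulN1r mulrN.
by congr (A _ _ * A _ _ - A _ _ * A _ _); apply/val_inj.
Qed.

(** The matrix is block diagonal with blocks [1 + B] and the identity. Writing it with elementary
    matrices makes its product with a basis column immediate. *)
Lemma det_1_add_corner (R : comNzRingType) (k : nat) (B : 'M[R]_2) :
  \det (1%:M + (B 0 0 *: delta_mx 0 0 + B 0 1 *: delta_mx 0 1
          + B 1 0 *: delta_mx 1 0 + B 1 1 *: delta_mx 1 1) : 'M_k.+2)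
  = (1 + B 0 0) * (1 + B 1 1) - B 0 1 * B 1 0.
Proof.
transitivity (\det (block_mx (1%:M + B) 0 0 (1%:M : 'M_k))); last first.
  by rewrite det_ublock det1 mulr1 det_mx2 !mxE !mulr1n !mulr0n !add0r.
congr (\det _); apply/(@matrixP _ (2 + k) (2 + k)) => i j.
have ord2 (l : 'I_2) : l = 0 \/ l = 1 by case: l => -[|[|//]] ?; [left|right]; apply: val_inj.
have [i' ->|i' ->] := @split_ordP 2 k i; have [j' ->|j' ->] := @split_ordP 2 k j.
- rewrite [RHS](@block_mxEul _ 2 k 2 k); case: (ord2 i') => ->; case: (ord2 j') => ->;
    by rewrite !mxE -!val_eqE /= ?mulr0 ?mulr1 ?addr0 ?add0r.
- rewrite [RHS](@block_mxEur _ 2 k 2 k); case: (ord2 i') => ->;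
    by rewrite !mxE -!val_eqE /= !mulr0 !addr0.
- rewrite [RHS](@block_mxEdl _ 2 k 2 k); case: (ord2 j') => ->;
    by rewrite !mxE -!val_eqE /= !mulr0 !addr0.
- by rewrite [RHS](@block_mxEdr _ 2 k 2 k) !mxE -!val_eqE /= !mulr0 !addr0 eqn_add2l.
Qed.

Lemma Gamma_orbit_delta2 (k m : nat) (s d : int) :
  coprimez (1 + m%:Z * s) (m%:Z * d) ->
  Gamma_orbit m (delta_mx 0 0 : 'cV[int]_k.+2)
    (delta_mx 0 0 + m%:Z *: (s *: delta_mx 0 0 + d *: delta_mx 1 0)).
Proof.
move=> co_xd.
(* Coprimality with [m] supplies a second factor [m] in the Bezout relation; it makes the upper
   right entry [- m p] divisible by [m]. *)
have co_xm : coprimez (1 + m%:Z * s) m%:Z.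
  by apply/coprimezP; exists (1, - s); rewrite /=; ring.
have /coprimezP[[q p] /= qp] : coprimez (1 + m%:Z * s) (m%:Z * (m%:Z * d)).
  by rewrite coprimezMr co_xm.
(* Solving [q (1 + m s) + p m^2 d = 1] for [q] gives [q = 1 + m t], so [q] can serve as a diagonal
   entry. The corner [1 + m B] then has rows [(1 + m s, - m p)] and [(m d, q)], and the Bezout
   relation is its determinant. *)
pose t := - (s * q + m%:Z * d * p).
have defq : q = 1 + m%:Z * t.
  by rewrite /t -[X in X + _]qp; ring.
pose B : 'M[int]_2 :=
  \matrix_(i, j) (nth [::] [:: [:: s; - p]; [:: d; t]] i)`_j.
pose X : 'M[int]_k.+2 := B 0 0 *: delta_mx 0 0 + B 0 1 *: delta_mx 0 1
          + B 1 0 *: delta_mx 1 0 + B 1 1 *: delta_mx 1 1.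
exists (1%:M + m%:Z *: X).
  apply/GammaP; split; last by exists X.
  have -> : m%:Z *: X = (m%:Z *: B) 0 0 *: delta_mx 0 0
     + (m%:Z *: B) 0 1 *: delta_mx 0 1 + (m%:Z *: B) 1 0 *: delta_mx 1 0
     + (m%:Z *: B) 1 1 *: delta_mx 1 1.
    by rewrite /X !scalerDr !scalerA ![(_ *: B) _ _]mxE.
  rewrite det_1_add_corner !mxE /= -defq -[RHS]qp; ring.
rewrite mulmxDl mul1mx -scalemxAl /X !mulmxDl -!scalemxAl.
by rewrite !mul_delta_mx_cond /= !mulr1n !mulr0n !scaler0 !addr0 !mxE.
Qed.

Lemma Gamma_orbit_delta (k m : nat) (y : 'cV[int]_k.+2) (c : 'rV[int]_k.+2) :
  c *m (delta_mx 0 0 + m%:Z *: y) = 1%:M ->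
  Gamma_orbit m (delta_mx 0 0) (delta_mx 0 0 + m%:Z *: y).
Proof.
move=> cv.
have [h hU [d hy]] := unitmx_mul_delta (dsubmx (y : 'cV_(1 + k.+1))).
(* [H] fixes the first basis vector and collapses the entries of [y] below the first to the single
   entry [d]. *)
pose H : 'M[int]_(1 + k.+1) := block_mx 1%:M 0 0 h.
have HU : H \in unitmx by rewrite unitmxE det_ublock det1 mul1r -unitmxE.
have col2E (s t : int) : col_mx s%:M (t *: delta_mx 0 0) =
    s *: delta_mx 0 0 + t *: delta_mx 1 0 :> 'cV[int]_(1 + k.+1).
  apply/matrixP=> i j; rewrite (ord1 j) !mxE; case: split_ordP => l ->.
    by rewrite (ord1 l) !mxE -!val_eqE /= mulr1 mulr0 addr0.
  by rewrite !mxE -!val_eqE /= mulr0 add0r.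
have delta0 : delta_mx 0 0 = col_mx 1%:M 0 :> 'cV[int]_(1 + k.+1).
  by have := col2E 1 0; rewrite !scale0r addr0 scale1r.
have He : H *m delta_mx 0 0 = delta_mx 0 0 :> 'cV[int]_(1 + k.+1).
  by rewrite delta0 mul_block_col !mul0mx !mulmx0 mul1mx !addr0.
have Hy : H *m y = y 0 0 *: delta_mx 0 0 + d *: delta_mx 1 0 :> 'cV[int]_(1 + k.+1).
  rewrite -col2E -[X in H *m X](@vsubmxK _ 1 k.+1) mul_block_col hy.
  rewrite !mul0mx mul1mx addr0 add0r.
  congr col_mx; apply/matrixP=> i j; rewrite !ord1 !mxE mulr1n.
  by congr (y _ _); apply: val_inj.
apply: (@Gamma_orbit_unitmx _ _ H) => //.
have Hv : H *m (delta_mx 0 0 + m%:Z *: y) =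
  delta_mx 0 0 + m%:Z *: (y 0 0 *: delta_mx 0 0 + d *: delta_mx 1 0).
  by rewrite mulmxDr -scalemxAr Hy He.
rewrite Hv He.
apply: Gamma_orbit_delta2; apply/coprimezP.
have := congr1 (fun M : 'M_1 => M 0 0) cv.
(* The row [b], which is [c] times the inverse of [H], pairs to 1 with a column supported on two
   entries; its first two coefficients are the Bezout coefficients sought. *)
rewrite -[X in c *m X](mulKmx HU) Hv mulmxA.
move: (c *m _) => b.
rewrite scalerDr addrA !scalerA -[X in X + _ + _]scale1r -scalerDl mulmxDr -!scalemxAr.
rewrite -!colE !mxE => eq1.
by exists (b 0 0, b 0 1); rewrite -[RHS]eq1 /= mulrC (mulrC (b 0 1)).
Qed.

Lemma Gamma_orbit_primitive (k m : nat) (u y : 'cV[int]_k.+2)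
    (b c : 'rV[int]_k.+2) :
  b *m u = 1%:M -> c *m (u + m%:Z *: y) = 1%:M ->
  Gamma_orbit m u (u + m%:Z *: y).
Proof.
move=> bu cv; have [g gU gu] := unitmx_mul_primitive bu.
apply: (Gamma_orbit_unitmx gU).
rewrite mulmxDr -scalemxAr gu; apply: (@Gamma_orbit_delta _ _ _ (c *m invmx g)).
by rewrite -gu scalemxAr -mulmxDr -mulmxA mulKmx.
Qed.

Lemma entries_idealP (n : nat) (u : 'cV[int]_n) (x : int) :
  entries_ideal u x <-> exists c : 'rV[int]_n, c *m u = x%:M.
Proof.
split=> [[c ->]|[c cu]].
  exists (\row_i c i); apply/matrixP=> i j; rewrite !ord1 !mxE eqxx mulr1n.
  by apply: eq_bigr => l _; rewrite mxE.
exists (c 0); have := congr1 (fun M : 'M_1 => M 0 0) cu.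
by rewrite !mxE eqxx mulr1n.
Qed.

Lemma entries_ideal_mulmx (n : nat) (A : 'M[int]_n) (u : 'cV[int]_n) (x : int) :
  entries_ideal (A *m u) x -> entries_ideal u x.
Proof.
by move=> /entries_idealP[c cAu]; apply/entries_idealP; exists (c *m A); rewrite -mulmxA.
Qed.

Lemma entries_ideal_scale (n : nat) (u : 'cV[int]_n) (a : int) :
  same_ideal (entries_ideal u) (principal_ideal a) ->
  exists u' : 'cV[int]_n, u = a *: u'.
Proof.
move=> ha; have dvdu i : (a %| u i ord0)%Z.
  have /ha[k ->] : entries_ideal u (u i ord0); last exact: dvdz_mulr.
  apply/entries_idealP; exists (delta_mx 0 i).
  by rewrite -rowE; apply/matrixP=> l j; rewrite !ord1 !mxE eqxx.
exists (\col_i (u i ord0 %/ a)%Z); apply/matrixP=> i j.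
by rewrite (ord1 j) !mxE mulrC divzK.
Qed.

Theorem theorem4p13 (n m : nat) (hn : (2 <= n)%N) (hm : (0 < m)%N)
    (u v : 'cV[int]_n) (hu : u <> 0) (hv : v <> 0)
    (a : int) (ha : same_ideal (entries_ideal u) (principal_ideal a)) :
  Gamma_orbit m u v <->
  same_ideal (entries_ideal u) (entries_ideal v) /\
  (forall i : 'I_n, (u i ord0 = v i ord0 %[mod a * m%:Z])%Z).
Proof.
have [u' defu] := entries_ideal_scale ha.
split=> [[A /GammaP[detA [X defA]] ->{v hv}]|[huv cong]].
  have AU : A \in unitmx by rewrite unitmxE detA unitr1.
  split=> [x|i].
    split; last exact: entries_ideal_mulmx.
    (* The reverse inclusion applies the same lemma to the inverse of [A]. *)
    by rewrite -{1}(mulKmx AU u); apply: entries_ideal_mulmx.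
  (* The difference is [m X u = a m X u'], hence the modulus [a m] and not just [m]. *)
  apply/eqP; rewrite eq_sym eqz_mod_dvd defA mulmxDl mul1mx mxE addrAC subrr add0r.
  by rewrite defu -scalemxAl -scalemxAr scalerA mulrC mxE dvdz_mulr.
have a0 : a != 0 by apply/eqP=> a0; apply: hu; rewrite defu a0 scale0r.
have hav : same_ideal (entries_ideal v) (principal_ideal a).
  by move=> x; split=> [/huv/ha|/ha/huv].
have [v' defv] := entries_ideal_scale hav.
(* Since [a] lies in the ideal, [c (a w) = a] for some row [c], and cancelling the nonzero [a] gives
   [c w = 1]. *)
have primitive w : same_ideal (entries_ideal (a *: w)) (principal_ideal a) ->
    exists c : 'rV[int]_n, c *m w = 1%:M.
  move=> hw; have /hw/entries_idealP[c cw] : principal_ideal a a.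
    by exists 1; rewrite mulr1.
  exists c; apply/matrixP=> i j; apply: (mulfI a0).
  have := congr1 (fun M : 'M_1 => M i j) cw.
  by rewrite -scalemxAr [LHS]mxE => ->; rewrite !mxE mulr_natr.
have [b bu] : exists b : 'rV[int]_n, b *m u' = 1%:M by apply: primitive; rewrite -defu.
have [c cv] : exists c : 'rV[int]_n, c *m v' = 1%:M by apply: primitive; rewrite -defv.
(* Dividing the congruence modulo [a m] by [a] leaves one modulo [m] between [u'] and [v']. *)
have [y defy] : exists y : 'cV[int]_n, v' = u' + m%:Z *: y.
  have dvd_uv i : (m%:Z %| v' i ord0 - u' i ord0)%Z.
    rewrite -(dvdz_mul2l a0) mulrBr.
    by have /esym/eqP := cong i; rewrite eqz_mod_dvd defu defv !mxE.
  exists (\col_i ((v' i ord0 - u' i ord0) %/ m)%Z); apply/matrixP=> i j.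
  by rewrite (ord1 j) !mxE [_ * _]mulrC divzK // addrC subrK.
rewrite defu defv; apply: Gamma_orbitZ.
case: n hn u' v' b c y bu cv defy {u v hu hv ha huv hav cong primitive defu defv}
  => [|[|k]] // _ u' v' b c y bu cv defy.
by rewrite defy in cv *; apply: Gamma_orbit_primitive bu cv.
Qed.
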